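(* For each positive integer $i$ let $p_i$ denote the $i$th prime, and for each positive integer $k$ let $n = n_k = p_1 p_2 \cdots p_k$. Then $p_{\mathrm{dd}}(n) = p_{\mathrm{dsd}}(n)$ for every $k$, and as $k \to \infty$, \[ p_{\mathrm{dd}}(n) = p_{\mathrm{dsd}}(n) \gtrsim \frac{2^{d(n)/4} \log n}{n \log\log n} = \exp\left(\exp\left((\log 2 + o(1)) \frac{\log n}{\log\log n}\right)\right). \]
   Context: For a positive integer $n$: $p_{\mathrm{dd}}(n)$ is the number of partitions of $n$ into distinct divisors of $n$, i.e. the number of sets of positive divisors of $n$ whose elements sum to $n$ (the divisor $n$ itself is allowed). $p_{\mathrm{dsd}}(n)$ is the number of partitions of $n$ into distinct squarefree divisors of $n$, i.e. the number of sets of squarefree positive divisors of $n$ whose elements sum to $n$. $d(n)$ is the number of positive divisors of $n$. The notation $f(n) \gtrsim g(n)$ (for positive $f, g$) means $f(n) \geq (1 + o(1)) g(n)$, i.e. $\liminf f(n)/g(n) \geq 1$, with the limit taken along $n = n_k$ as $k \to \infty$; the $o(1)$ term also tends to $0$ as $k \to \infty$. *)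

(* Defs.v *)
From mathcomp Require Import all_boot all_order all_algebra.
From mathcomp Require Import all_classical all_reals all_analysis.
Set Implicit Arguments.
Unset Strict Implicit.
Unset Printing Implicit Defensive.
Import Order.TTheory GRing.Theory Num.Theory numFieldNormedType.Exports.

Local Open Scope nat_scope.

Definition squarefree (n : nat) : bool :=
  [forall d : 'I_n.+1, (d ^ 2 %| n) ==> (d == 1 :> nat)].

Lemma squarefreeP (n : nat) :
  0 < n -> reflect (forall d, d ^ 2 %| n -> d = 1) (squarefree n).
Proof.
move=> n_gt0; apply: (iffP forallP) => [sqf d d2n|sqf d].
  have dn : d < n.+1.
    by rewrite ltnS dvdn_leq// (dvdn_trans _ d2n)// dvdn_exp.
  by have /implyP/(_ d2n)/eqP := sqf (Ordinal dn).
by apply/implyP => /sqf ->.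
Qed.

(* A set of divisors of n > 0 is a subset of {0, ..., n}; 0 is never a member
   since it does not divide n. *)
Definition pdd (n : nat) : nat :=
  #|[set A : {set 'I_n.+1} |
      [forall d in A, (d : nat) %| n] && (\sum_(d in A) (d : nat) == n)]|.

Definition pdsd (n : nat) : nat :=
  #|[set A : {set 'I_n.+1} |
      [forall d in A, ((d : nat) %| n) && squarefree d]
      && (\sum_(d in A) (d : nat) == n)]|.

Definition num_divisors (n : nat) : nat := size (divisors n).

Lemma exists_prime_above (m : nat) : exists p, (m < p) && prime p.
Proof. by have [p mp pp] := prime_above m; exists p; rewrite mp pp. Qed.

Definition next_prime (m : nat) : nat := ex_minn (exists_prime_above m).

(* 1-based: nth_prime 1 = 2, nth_prime 2 = 3; nth_prime 0 is a dummy value. *)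
Definition nth_prime (i : nat) : nat := iter i next_prime 0.

Definition primorial (k : nat) : nat := \prod_(1 <= i < k.+1) nth_prime i.

Local Open Scope classical_set_scope.
Local Open Scope ring_scope.

(* f k >= (1 + o(1)) * g k as k tends to infinity. *)
Definition gtrsim (R : realType) (f g : nat -> R) : Prop :=
  exists2 e : nat -> R, e @ \oo --> (0 : R) &
    \forall k \near \oo, (1 + e k) * g k <= f k.

(* Main.v *)
Require Import Defs.
From mathcomp Require Import all_boot all_order all_algebra.
From mathcomp Require Import all_classical all_reals all_analysis.
From mathcomp Require Import zify ring lra.
Import Order.TTheory GRing.Theory Num.Theory numFieldNormedType.Exports.
Set Implicit Arguments.
Unset Strict Implicit.
Unset Printing Implicit Defensive.

(** Write [N = p * n], where [p] is the [k]-th prime and [n] the product of the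
    preceding ones, so that [d(N) = 2 ^ k = 2 d(n)].  The equality of the two
    partition functions is [pdd_primorial].

    For the lower bound, the divisors of [n] with [d ^ 2 <= n] are called small;
    they make up at least half of the divisors of [n], that is, at least
    [d(N) / 4] numbers.  In [pdd_mul_prime], every set [A] of small divisors is
    completed to a set of divisors of [N] with sum [N], in an injective way.
    One takes [p * d] for [d] in [A], adds [p * d] for [d] in a fixed set of
    large divisors of [n], chosen so that the sum falls short of [N] by a
    nonnegative amount at most [n], and writes this amount as a sum of distinct
    divisors of [n].  The last step is possible because primorials are
    practical numbers ([practical_primorial]), and the new divisors differ from
    the others because [p] does not divide them.  It needs that the small
    divisors have a small sum, which holds as soon as [k] is large
    ([near_nth_prime_growth]).  Hence [pdd N >= 2 ^ (d(N) / 4)] eventually,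
    which exceeds the required bound, since [ln N / (N ln (ln N))] is
    eventually at most [1].

    For the second form of the bound, its double logarithm is
    [k ln 2 + O(1)] ([near_ln_bounds]), so the claim is that [k] is asymptotic
    to [ln N / ln (ln N)] ([cvg_primorial_omega]).  Because
    [k! <= N <= p ^ k], this reduces to [ln p] being asymptotic to [ln k], and
    that follows from the lower bound of Chebyshev type [2 ^ p <= p ^ (4 k)],
    obtained from the factorization of central binomial coefficients
    ([expn2_nth_prime]). *)

(** * The sequence of primes and its primorials *)

Section Arithmetic.
Local Open Scope nat_scope.

Lemma next_primeP m :
  [/\ prime (next_prime m), m < next_prime m &
      forall q, prime q -> m < q -> next_prime m <= q].
Proof.
rewrite /next_prime; case: ex_minnP => p /andP[mp pp] pmin; split => // q pq mq.
by apply: pmin; rewrite mq.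
Qed.

Lemma prime_nth_prime i : prime (nth_prime i.+1).
Proof. by rewrite /nth_prime iterS; case: (next_primeP (iter i next_prime 0)). Qed.

Lemma nth_prime_ltS i : nth_prime i < nth_prime i.+1.
Proof. by rewrite /nth_prime iterS; case: (next_primeP (iter i next_prime 0)). Qed.

Lemma nth_prime_next i q : prime q -> nth_prime i < q -> nth_prime i.+1 <= q.
Proof.
by rewrite /nth_prime iterS; case: (next_primeP (iter i next_prime 0)) => _ _; apply.
Qed.

Lemma nth_prime_ge i : i <= nth_prime i.
Proof. by elim: i => // i IH; apply: leq_ltn_trans IH (nth_prime_ltS i). Qed.

Lemma primorialS k : primorial k.+1 = nth_prime k.+1 * primorial k.
Proof. by rewrite /primorial big_nat_recr//= mulnC. Qed.

Lemma primorial0 : primorial 0 = 1.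
Proof. by rewrite /primorial big_nil. Qed.

Lemma primorial_gt0 k : 0 < primorial k.
Proof.
elim: k => [|k IH]; rewrite ?primorial0// primorialS muln_gt0 IH.
by rewrite prime_gt0 ?prime_nth_prime.
Qed.

Lemma prime_dvd_primorial q k : prime q -> q %| primorial k -> q <= nth_prime k.
Proof.
move=> pq; elim: k => [|k IH].
  by rewrite primorial0 dvdn1 => /eqP q1; rewrite q1 in pq.
rewrite primorialS Euclid_dvdM// => /orP[|/IH qk].
  by rewrite dvdn_prime2 ?prime_nth_prime// => /eqP->.
by rewrite (leq_trans qk)// ltnW ?nth_prime_ltS.
Qed.

Lemma nth_prime_ndvd_primorial k : ~~ (nth_prime k.+1 %| primorial k).
Proof.
apply/negP => /(prime_dvd_primorial (prime_nth_prime k)).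
by rewrite leqNgt nth_prime_ltS.
Qed.

Lemma prime_le_dvd_primorial q k : prime q -> q <= nth_prime k -> q %| primorial k.
Proof.
move=> pq; elim: k => [|k IH] le_qk.
  by rewrite leqn0 in le_qk; rewrite (eqP le_qk) in pq.
rewrite primorialS; have [le_q|lt_q] := leqP q (nth_prime k).
  by rewrite dvdn_mull ?IH.
suff -> : q = nth_prime k.+1 by rewrite dvdn_mulr.
by apply/eqP; rewrite eqn_leq le_qk nth_prime_next.
Qed.

(** Euclid's argument: a prime factor of [primorial k + 1] exceeds the first
    [k] primes. *)
Lemma nth_prime_le_primorialS k : nth_prime k.+1 <= (primorial k).+1.
Proof.
have P1 : 1 < (primorial k).+1 by rewrite ltnS primorial_gt0.
apply: leq_trans (pdiv_leq (ltnW P1)); apply: nth_prime_next (pdiv_prime P1) _.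
rewrite ltnNge; apply/negP => /(prime_le_dvd_primorial (pdiv_prime P1)) dP.
have := pdiv_dvd (primorial k).+1; rewrite -[X in _ %| X]addn1 dvdn_addr// dvdn1.
by apply/negP; rewrite neq_ltn prime_gt1 ?orbT// pdiv_prime.
Qed.

Lemma nth_prime_surj q k : prime q -> q <= nth_prime k ->
  exists2 i, 0 < i <= k & q = nth_prime i.
Proof.
move=> pq; elim: k => [|k IH] le_qk.
  by rewrite leqn0 in le_qk; rewrite (eqP le_qk) in pq.
have [/IH[i /andP[i0 ik] ->]|lt_q] := leqP q (nth_prime k).
  by exists i; rewrite // i0 ltnW.
by exists k.+1; [rewrite leqnn|apply/eqP; rewrite eqn_leq le_qk nth_prime_next].
Qed.

Lemma squarefree_primorial k d : d ^ 2 %| primorial k -> d = 1.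
Proof.
elim: k => [|k IH]; first by rewrite primorial0 dvdn1 -[1]/(1 ^ 2) eqn_sqr => /eqP.
rewrite primorialS; set p := nth_prime k.+1; have pp : prime p := prime_nth_prime k.
have [pd|pNd d2] := boolP (p %| d).
  have /dvdn_trans/[apply] : p ^ 2 %| d ^ 2 by rewrite dvdn_exp2r.
  by rewrite -mulnn dvdn_pmul2l ?prime_gt0// (negPf (nth_prime_ndvd_primorial k)).
apply: IH; rewrite -(@Gauss_dvdr _ p)// coprime_sym coprimeXr//.
by rewrite prime_coprime.
Qed.

(** A divisor of a squarefree number is squarefree, so the two counting
    functions range over the same sets. *)
Lemma pdd_primorial k : pdd (primorial k) = pdsd (primorial k).
Proof.
rewrite /pdd /pdsd; apply: eq_card => A; rewrite !inE; congr (_ && _).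
apply: eq_forallb => d; have [dA|//] := boolP (d \in A); rewrite /=.
have [dn|//] := boolP (_ %| _); rewrite /=; apply/esym/squarefreeP.
  by rewrite (dvdn_gt0 (primorial_gt0 k)).
by move=> e e2d; apply: squarefree_primorial (dvdn_trans e2d dn).
Qed.

(** * Practical numbers *)

Lemma divisors_mul_prime p n : prime p -> ~~ (p %| n) ->
  perm_eq (divisors (p * n)) (divisors n ++ map (muln p) (divisors n)).
Proof.
move=> pp pn; have n0 : 0 < n by case: (n) pn => //; rewrite dvdn0.
have p0 := prime_gt0 pp.
apply: uniq_perm => [||d]; first exact: divisors_uniq.
  rewrite cat_uniq divisors_uniq map_inj_uniq ?divisors_uniq ?andbT/=; last first.
    by move=> x y /eqP; rewrite eqn_pmul2l// => /eqP.
  apply/hasPn => _ /mapP[e _ ->]; rewrite -dvdn_divisors//.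
  by apply: contra pn; apply: dvdn_trans; rewrite dvdn_mulr.
rewrite mem_cat -!dvdn_divisors ?muln_gt0 ?p0//.
have [/dvdnP[e ->]|pd] := boolP (p %| d).
  rewrite mulnC dvdn_pmul2l// mem_map; last first.
    by move=> x y /eqP; rewrite eqn_pmul2l// => /eqP.
  rewrite -dvdn_divisors//; have [en|_] := boolP (e %| n); first by rewrite orbT.
  rewrite orbF; apply/esym/negbTE; apply: contra pn.
  by apply: dvdn_trans; rewrite dvdn_mulr.
rewrite Gauss_dvdr 1?coprime_sym ?prime_coprime//.
case: (_ %| n) => //=; apply/esym/negbTE/mapP => -[e _ de].
by rewrite de dvdn_mulr in pd.
Qed.

Lemma num_divisors_mul_prime p n : prime p -> ~~ (p %| n) ->
  num_divisors (p * n) = 2 * num_divisors n.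
Proof.
move=> pp pn; rewrite /num_divisors (perm_size (divisors_mul_prime pp pn)).
by rewrite size_cat size_map mul2n addnn.
Qed.

Lemma num_divisors_primorial k : num_divisors (primorial k) = 2 ^ k.
Proof.
elim: k => [|k IH]; first by rewrite primorial0.
rewrite primorialS num_divisors_mul_prime ?IH ?expnS ?prime_nth_prime//.
exact: nth_prime_ndvd_primorial.
Qed.

(** As [p] does not divide [n], a set of divisors of [p * n] is the same thing
    as a pair of sets of divisors of [n]: [P] selects the divisors prime to
    [p], and [Q] the cofactors of the multiples of [p]. *)
Lemma sum_divisors_mul_prime p n (P Q : pred nat) : prime p -> ~~ (p %| n) ->
  \sum_(d <- divisors (p * n) | if p %| d then Q (d %/ p) else P d) d =
  p * \sum_(d <- divisors n | Q d) d + \sum_(d <- divisors n | P d) d.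
Proof.
move=> pp pn; rewrite (perm_big _ (divisors_mul_prime pp pn)) big_cat big_map /= addnC.
have n0 : 0 < n by case: (n) pn => //; rewrite dvdn0.
congr (_ + _); last first.
  rewrite big_seq_cond [RHS]big_seq_cond; apply: eq_bigl => d.
  have [dn|//] := boolP (_ \in _); rewrite -dvdn_divisors// in dn.
  by rewrite ifN//; apply: contra pn => /dvdn_trans; apply.
rewrite big_distrr /=; apply: eq_bigl => d.
by rewrite dvdn_mulr// mulKn// prime_gt0.
Qed.

(** Practical numbers in the sense of Srinivasan; a set of divisors is given by
    its indicator [P]. *)
Definition practical n := forall t, t <= \sum_(d <- divisors n) d ->
  exists P : pred nat, \sum_(d <- divisors n | P d) d = t.

(** Write [t = p * q + r] with [q] and [r] at most the divisor sum [s] of [n],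
    and represent [q] and [r] separately.  Euclidean division of [t] by [p]
    does this unless the quotient exceeds [s]; its remainder is at most [s]
    because [p <= s + 1].  For a larger quotient, [q = s] works. *)
Lemma practical_mul_prime p n : prime p -> ~~ (p %| n) -> practical n ->
  p <= (\sum_(d <- divisors n) d).+1 -> practical (p * n).
Proof.
set s := (X in _ <= X.+1) => pp pn prac_n ps t le_t.
have {}le_t : t <= p * s + s.
  rewrite -(sum_divisors_mul_prime xpredT xpredT pp pn); apply: leq_trans le_t _.
  by apply/eq_leq/eq_bigl => d; case: ifP.
have [q [r [qs rs ->]]] : exists q r, [/\ q <= s, r <= s & t = p * q + r].
  have [le_tq|lt_qt] := leqP (t %/ p) s.
    exists (t %/ p), (t %% p); split=> //; last by rewrite {1}(divn_eq t p) mulnC.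
    by rewrite -ltnS (leq_trans _ ps)// ltn_pmod// prime_gt0.
  exists s, (t - p * s); split => //; first by rewrite leq_subLR.
  by rewrite subnKC// mulnC (leq_trans _ (leq_trunc_div t p))// leq_mul2r (ltnW lt_qt) orbT.
have [[Q <-] [P <-]] := (prac_n _ qs, prac_n _ rs).
exists (fun d => if p %| d then Q (d %/ p) else P d).
exact: sum_divisors_mul_prime.
Qed.

Lemma leq_sum_divisors n : 0 < n -> n <= \sum_(d <- divisors n) d.
Proof.
by move=> n0; rewrite (big_rem n) ?leq_addr//= divisors_id.
Qed.

(** Euclid's bound on the next prime is the size condition of
    [practical_mul_prime], since the divisor sum of [n] is at least [n]. *)
Lemma practical_primorial k : practical (primorial k).
Proof.
elim: k => [|k IH].
  move=> t; rewrite primorial0 big_seq1; case: t => [|[|//]] _.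
    by exists pred0; rewrite big_pred0.
  by exists predT; rewrite big_seq1.
rewrite primorialS; apply: practical_mul_prime;
  rewrite ?prime_nth_prime ?nth_prime_ndvd_primorial//.
by rewrite (leq_trans (nth_prime_le_primorialS k))// ltnS leq_sum_divisors ?primorial_gt0.
Qed.

(** * Many representations by distinct divisors *)

Lemma sum_ord_divisors n (P : pred nat) : 0 < n ->
  \sum_(x < n.+1 | (x %| n) && P x) x = \sum_(d <- divisors n | P d) d.
Proof.
move=> n0; rewrite -[RHS]big_filter -(big_mkord (fun x => (x %| n) && P x) (fun x => x)).
rewrite -big_filter; apply/perm_big/uniq_perm; rewrite ?filter_uniq ?iota_uniq ?divisors_uniq//.
move=> d; rewrite !mem_filter -dvdn_divisors// mem_index_iota ltnS andbC andbA andbC /=.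
by have [/dvdn_leq->//|] := boolP (d %| n); rewrite ?andbF.
Qed.

(** The comparison [d ^ 2 <= n] is not strict, so that [d] or [n / d] is small
    for every divisor [d], also when [n] is a square. *)
Definition small_divisors n := [set d : 'I_n.+1 | (d %| n) && (d ^ 2 <= n)].

(** The involution [d |-> n / d] sends the large divisors to small ones. *)
Lemma card_small_divisors n : 0 < n -> num_divisors n <= 2 * #|small_divisors n|.
Proof.
move=> n0; pose D := [set d : 'I_n.+1 | d %| n].
have -> : num_divisors n = #|D|.
  rewrite /num_divisors -sum1_size -[RHS]sum1dep_card.
  rewrite -(big_mkord (fun x => x %| n) (fun=> 1)) -[RHS]big_filter.
  apply/perm_big/uniq_perm; rewrite ?filter_uniq ?iota_uniq ?divisors_uniq// => d.
  rewrite !mem_filter -dvdn_divisors// mem_index_iota ltnS andbC /=.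
  by have [/dvdn_leq->//|] := boolP (d %| n); rewrite ?andbF.
rewrite mul2n -addnn; pose cod (d : 'I_n.+1) : 'I_n.+1 := inord (n %/ d).
have codE d : cod d = n %/ d :> nat by rewrite inordK// ltnS leq_div.
apply: (@leq_trans #|small_divisors n :|: cod @: small_divisors n|); last first.
  by rewrite (leq_trans (leq_card_setU _ _))// leq_add2l leq_imset_card.
apply/subset_leq_card/fintype.subsetP => d; rewrite !inE => dn; rewrite dn /=.
have [//|lt_nd/=] := leqP (d ^ 2) n.
have d0 : 0 < d by rewrite (dvdn_gt0 n0).
apply/imsetP; exists (cod d); last by apply/val_inj; rewrite /= !codE divnA// mulKn.
rewrite inE codE; move/dvdnP: dn => [e en].
have -> : n %/ d = e by rewrite {1}en mulnK.
apply/andP; split; first by apply/dvdnP; exists d; rewrite mulnC.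
move: lt_nd en; move: (nat_of_ord d) => c; rewrite -!mulnn => + en; rewrite en.
by rewrite ltn_mul2r => /andP[_ /ltnW]; rewrite leq_mul2l orbC => ->.
Qed.

(** Every set [A] of small divisors of [n] extends to a set of divisors of
    [p * n] with sum [p * n].  The extension contains [p * d] for [d] in [A],
    and [p * d] for [d] in a fixed set of large divisors whose sum [h] is
    slightly below [n].  The rest, [p * (n - h - sum of A)], lies between [0]
    and [n], so it is a sum of divisors of [n] itself because [n] is practical;
    these are prime to [p], hence distinct from the former ones.  Reading off
    the small cofactors of the multiples of [p] gives [A] back, so the
    extension is injective. *)
Lemma pdd_mul_prime n p : prime p -> ~~ (p %| n) -> practical n ->
  2 * p * \sum_(d in small_divisors n) d <= n ->
  2 ^ #|small_divisors n| <= pdd (p * n).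
Proof.
move=> pp pn prac_n; set s := \sum_(d in _) _ => ps_n.
have n0 : 0 < n by case: (n) pn => //; rewrite dvdn0.
have p0 := prime_gt0 pp; have pn0 : 0 < p * n by rewrite muln_gt0 p0.
have sn : s <= n by apply: leq_trans ps_n; rewrite leq_pmull ?muln_gt0.
have sE : s = \sum_(d <- divisors n | d ^ 2 <= n) d.
  by rewrite -sum_ord_divisors//; apply: eq_bigl => d; rewrite inE.
(* [n - s] leaves room for any [A]; discarding the small divisors of [B] loses
   at most another [s]. *)
have [B sumB] : exists B : pred nat, \sum_(d <- divisors n | B d) d = n - s.
  by apply: prac_n; rewrite (leq_trans (leq_subr _ _))// leq_sum_divisors.
pose h := \sum_(d <- divisors n | B d && ~~ (d ^ 2 <= n)) d.
have [h_le h_ge] : h + s <= n /\ n <= h + 2 * s.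
  have := sumB; rewrite (bigID (fun d => d ^ 2 <= n)) /= -/h.
  set x := \sum_(d <- _ | _) d => eq_h.
  have : x <= s.
    rewrite sE [leqRHS](bigID B) /=.
    by under eq_bigl do rewrite andbC; rewrite leq_addr.
  by lia.
pose Q (A : {set 'I_n.+1}) d := if d ^ 2 <= n then inord d \in A else B d.
have sumQ (A : {set 'I_n.+1}) : A \subset small_divisors n ->
    \sum_(d <- divisors n | Q A d) d = \sum_(d in A) d + h.
  move=> sA; rewrite (bigID (fun d => d ^ 2 <= n)) /=; congr (_ + _); last first.
    by apply: eq_bigl => d; rewrite /Q; case: ifP; rewrite ?andbF ?andbT.
  rewrite -sum_ord_divisors//; apply: eq_bigl => d; rewrite /Q.
  case: ifP => [d2|d2]; rewrite ?inord_val ?andbT ?andbF.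
    by have [/(fintype.subsetP sA)|] := boolP (d \in A); rewrite ?inE ?andbF// => /andP[->].
  by apply/esym/negbTE/negP => /(fintype.subsetP sA); rewrite inE d2 andbF.
(* The rest is at most [2 * p * s]. *)
have /choice[P sumP] : forall A : {set 'I_n.+1}, exists P : pred nat,
    A \subset small_divisors n ->
    \sum_(d <- divisors n | P d) d = p * (n - h - \sum_(d in A) d).
  move=> A; have [sA|] := boolP (A \subset _); last by exists pred0.
  case: (prac_n (p * (n - h - \sum_(d in A) d))) => [|P <-]; last by exists P.
  apply: leq_trans (leq_sum_divisors n0); apply: leq_trans ps_n.
  by rewrite [2 * p]mulnC -mulnA leq_mul2l; apply/orP; right; lia.
pose T A d := if p %| d then Q A (d %/ p) else P A d.
pose F A := [set x : 'I_(p * n).+1 | (x %| p * n) && T A x].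
rewrite -card_powerset /pdd.
have F_inj : {in powerset (small_divisors n) &, injective F}.
  move=> A1 A2; rewrite !powersetE => sA1 sA2 eqF; apply/setP => d.
  have [dS|dNS] := boolP (d \in small_divisors n); last first.
    transitivity false; [|apply/esym]; apply/negbTE; apply: contra dNS => /=.
      exact: (fintype.subsetP sA1).
    exact: (fintype.subsetP sA2).
  move: dS; rewrite inE => /andP[dn d2].
  have pd : p * d < (p * n).+1 by rewrite ltnS leq_pmul2l// dvdn_leq.
  have /setP/(_ (Ordinal pd)) := eqF.
  by rewrite !inE /= dvdn_pmul2l// dn /T dvdn_mulr// mulKn// /Q d2 inord_val.
rewrite -(card_in_imset F_inj); apply/subset_leq_card/fintype.subsetP => _ /imsetP[A sA ->].
rewrite powersetE in sA; rewrite inE; apply/andP; split.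
  by apply/forall_inP => d; rewrite inE => /andP[].
rewrite (eq_bigl (fun x : 'I_(p * n).+1 => (x %| p * n) && T A x));
  last by move=> x; rewrite inE.
rewrite sum_ord_divisors// /T sum_divisors_mul_prime// sumQ// sumP// -mulnDr.
have leA : \sum_(d in A) d <= s.
  rewrite /s [leqRHS](bigID (mem A)) /= [X in _ <= X + _](eq_bigl (mem A)) ?leq_addr// => d /=.
  by have [/(fintype.subsetP sA)->|] := boolP (d \in A); rewrite ?andbF.
have leAn : h + \sum_(d in A) d <= n by rewrite (leq_trans _ h_le)// leq_add2l.
by rewrite -subnDA addnC [_ + h]addnC subnK.
Qed.

(** The hypothesis says that [2 * p * 2 ^ m] is at most the square root of [n],
    for [n] the product of the first [m] primes and [p] the next prime.  So
    each small divisor is at most [n / (2 * p * 2 ^ m)], and there are at most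
    [2 ^ m] of them. *)
Lemma pdd_primorial_ge m :
  4 * nth_prime m.+1 ^ 2 * 4 ^ m <= primorial m ->
  2 ^ (2 ^ m.-1) <= pdd (primorial m.+1).
Proof.
move=> le_P; set n := primorial m in le_P *; set p := nth_prime m.+1 in le_P *.
have n0 : 0 < n := primorial_gt0 m.
have card_D : 2 ^ m <= 2 * #|small_divisors n|.
  by rewrite -num_divisors_primorial card_small_divisors.
apply: (@leq_trans (2 ^ #|small_divisors n|)).
  rewrite leq_exp2l//; case: m @n @p {le_P n0} card_D => [|m] n p /=.
    by case: #|_|.
  by rewrite expnS leq_pmul2l.
rewrite primorialS; apply: pdd_mul_prime.
- exact: prime_nth_prime.
- exact: nth_prime_ndvd_primorial.
- exact: practical_primorial.
rewrite -(@leq_pmul2r (2 ^ m)) ?expn_gt0//.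
have card_S : #|small_divisors n| <= 2 ^ m.
  rewrite -num_divisors_primorial /num_divisors -/n cardE -(size_map val).
  apply: uniq_leq_size; first by rewrite map_inj_uniq ?enum_uniq//; apply: val_inj.
  by move=> _ /mapP[d + ->]; rewrite mem_enum inE -dvdn_divisors// => /andP[].
apply: (@leq_trans (\sum_(d in small_divisors n) n)); last first.
  by rewrite sum_nat_const mulnC leq_mul2l card_S orbT.
rewrite mulnAC big_distrr /=; apply: leq_sum => d; rewrite inE => /andP[_ d2].
rewrite -leq_sqr !expnMn -/p.
have -> : (2 ^ m) ^ 2 = 4 ^ m by rewrite -expnM mulnC expnM.
by rewrite -[leqRHS]mulnn leq_mul.
Qed.

(** * Chebyshev's lower bound for the number of primes *)

(** Legendre's formula, cut at any exponent beyond which the terms vanish, so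
    that the formulas for different factorials have a common range. *)
Lemma logn_fact_trunc p n t : prime p -> n < p ^ t.+1 ->
  logn p n`! = \sum_(1 <= k < t.+1) n %/ p ^ k.
Proof.
move=> pp nt; have p1 := prime_gt1 pp; rewrite logn_fact//.
have extend s : s <= n + t -> n < p ^ s.+1 ->
    \sum_(1 <= k < (n + t).+1) n %/ p ^ k = \sum_(1 <= k < s.+1) n %/ p ^ k.
  move=> st ns; rewrite (@big_cat_nat _ _ _ s.+1)//=.
  rewrite [X in _ + X]big_nat [X in _ + X]big1 ?addn0// => k /andP[sk _].
  by rewrite divn_small// (leq_trans ns)// leq_exp2l.
rewrite -(extend n) ?leq_addr//; last by rewrite (ltn_trans (ltn_expl _ p1))// ltn_exp2l.
by rewrite (extend t)// leq_addl.
Qed.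

(** In Legendre's formula for the central binomial coefficient, each exponent
    [k] contributes [(2 * n) %/ p ^ k - 2 * (n %/ p ^ k)], which is [0] or [1],
    and only exponents with [p ^ k <= 2 * n] occur. *)
Lemma expn_logn_central_bin p n : prime p -> 0 < n ->
  p ^ logn p 'C(2 * n, n) <= 2 * n.
Proof.
move=> pp n0; have p1 := prime_gt1 pp; set t := trunc_log p (2 * n).
suff le_t : logn p 'C(2 * n, n) <= t.
  by apply: leq_trans (trunc_logP p1 _); rewrite ?leq_exp2l// muln_gt0.
have n_le : n <= 2 * n by rewrite leq_pmull.
have lt_t : 2 * n < p ^ t.+1 := trunc_log_ltn _ p1.
have := congr1 (logn p) (bin_fact n_le).
have -> : 2 * n - n = n by lia.
rewrite !lognM ?bin_gt0 ?muln_gt0 ?fact_gt0//.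
rewrite !(@logn_fact_trunc p _ t)// ?(leq_ltn_trans n_le)// => eqC.
suff : \sum_(1 <= k < t.+1) 2 * n %/ p ^ k <= t + 2 * \sum_(1 <= k < t.+1) n %/ p ^ k.
  by rewrite -eqC; lia.
have tE : t = \sum_(1 <= k < t.+1) 1 by rewrite sum_nat_const_nat muln1 subn1.
rewrite [X in _ <= X + _]tE big_distrr -big_split /=.
apply: leq_sum => k _; have q0 : 0 < p ^ k by rewrite expn_gt0 ltnW.
by rewrite -ltnS ltn_divLR//; have := ltn_ceil n q0; nia.
Qed.

Lemma expn2_le_central_bin n : 2 ^ n <= 'C(2 * n, n).
Proof.
elim: n => // n IH; rewrite expnS; apply: leq_trans (_ : 2 * 'C(2 * n, n) <= _).
  by rewrite leq_mul2l.
have -> : 2 * n.+1 = (2 * n).+2 by lia.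
rewrite binS -[X in _ <= _ + X]bin_sub; last by lia.
have -> : (2 * n).+1 - n = n.+1 by lia.
by rewrite addnn mul2n leq_double binS leq_addl.
Qed.

(** Each prime power in the factorization is at most [2 * n], and the primes
    involved are among the first [k]. *)
Lemma central_bin_le_expn k n : 0 < n -> 2 * n < nth_prime k.+1 ->
  'C(2 * n, n) <= (2 * n) ^ k.
Proof.
move=> n0 lt_n; set c := 'C(_, _).
have c0 : 0 < c by rewrite bin_gt0; lia.
rewrite (prod_prime_decomp c0) prime_decompE big_map /=.
apply: (@leq_trans (\prod_(q <- primes c) (2 * n))).
  rewrite big_seq [leqRHS]big_seq; apply: leq_prod => q.
  by rewrite mem_primes => /andP[pq _]; rewrite expn_logn_central_bin.
rewrite big_const_seq count_predT iter_muln_1 leq_pexp2l ?muln_gt0//.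
rewrite -[leqRHS](size_iota 1) -[leqRHS](size_map nth_prime); apply: uniq_leq_size.
  exact: primes_uniq.
move=> q; rewrite mem_primes => /and3P[pq _ qc].
have q_le : q <= 2 * n.
  apply: leq_trans (expn_logn_central_bin pq n0).
  by rewrite -[leqLHS]expn1 leq_exp2l ?prime_gt1// logn_gt0 mem_primes pq c0.
have le_q : q <= nth_prime k.
  rewrite leqNgt; apply/negP => /(nth_prime_next pq) => le_q.
  by have := leq_ltn_trans (leq_trans le_q q_le) lt_n; rewrite ltnn.
have [i ik ->] := nth_prime_surj pq le_q.
by rewrite map_f// mem_iota add1n ltnS.
Qed.

Lemma fact_le_primorial k : k`! <= primorial k.
Proof.
by elim: k => [|k IH]; rewrite ?primorial0// primorialS factS leq_mul// nth_prime_ge.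
Qed.

Lemma primorial_le_expn k : primorial k <= nth_prime k ^ k.
Proof.
elim: k => [|k IH]; rewrite ?primorial0// primorialS expnS leq_mul//.
apply: leq_trans IH _; case: k => // k.
by rewrite leq_exp2r// ltnW// nth_prime_ltS.
Qed.

(** Chebyshev's bound for [n = (p - 1) / 2], where [p] is the [k]-th prime: the
    primes up to [2 * n] precede [p].  The factor [4] absorbs [p <= 4 * n] and
    covers [p = 2]. *)
Lemma expn2_nth_prime k : 0 < k -> 2 ^ nth_prime k <= nth_prime k ^ (4 * k).
Proof.
case: k => // k _; set p := nth_prime k.+1.
have p1 : 1 < p := prime_gt1 (prime_nth_prime k).
have [p_le2|p_gt2] := leqP p 2.
  have -> : p = 2 by apply/eqP; rewrite eqn_leq p_le2.
  by rewrite leq_exp2l//; lia.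
pose n := p.-1./2; have [n0 np pn] : [/\ 0 < n, 2 * n < p & p <= 4 * n].
  by rewrite /n; split; lia.
apply: (@leq_trans ((2 ^ n) ^ 4)); first by rewrite -expnM leq_exp2l// mulnC.
apply: (@leq_trans ((p ^ k) ^ 4)).
  rewrite leq_exp2r//; apply: leq_trans (expn2_le_central_bin n) _.
  apply: leq_trans (central_bin_le_expn n0 np) _.
  by case: (k) => // j; rewrite leq_exp2r// ltnW.
by rewrite -expnM leq_exp2l// mulnC leq_mul2l leqnSn orbT.
Qed.

End Arithmetic.

Local Open Scope classical_set_scope.
Local Open Scope ring_scope.

(** * Asymptotics of primorials *)

Section Asymptotics.
Variable R : realType.
Implicit Types (u v : nat -> R) (k : nat).

Lemma near_cvg u v (l : R) : v @ \oo --> l ->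
  (\forall k \near \oo, u k = v k) -> u @ \oo --> l.
Proof.
move=> + uv; apply: cvg_trans.
by refine (near_eq_cvg _); apply: filterS uv => k ->.
Qed.

Lemma cvgy_ln u : u @ \oo --> +oo -> ln (u k) @[k --> \oo] --> +oo.
Proof.
move=> uy; apply/cvgryPge => A; near=> k.
have uk : expR A <= u k by near: k; exact: cvgry_ge.
by rewrite -[A]expRK ler_ln ?posrE ?expR_gt0// (lt_le_trans _ uk) ?expR_gt0.
Unshelve. all: by end_near. Qed.

Lemma cvg0_invy u : u @ \oo --> +oo -> (u k)^-1 @[k --> \oo] --> 0.
Proof.
move=> uy; apply/gtr0_cvgV0 => //; near=> k.
by near: k; exact: cvgry_gt.
Unshelve. all: by end_near. Qed.

(** With [y = ln u], the bound [1 + y ^ 2 / 2 <= exp y = u] gives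
    [y / u <= 2 / y]. *)
Lemma cvg0_ln_div u : u @ \oo --> +oo -> ln (u k) / u k @[k --> \oo] --> 0.
Proof.
move=> uy; have lny := cvgy_ln uy.
apply: (@squeeze_cvgr _ _ _ _ (fun=> 0) (fun k => 2 * (ln (u k))^-1)); last 2 first.
- exact: cvg_cst.
- by rewrite -[0](mulr0 2); apply: cvgMr; exact: cvg0_invy.
near=> k.
have lnk : 0 < ln (u k) by near: k; exact: cvgry_gt.
have uk : 0 < u k by near: k; exact: cvgry_gt.
apply/andP; split; first by rewrite divr_ge0 ?ltW.
rewrite ler_pdivrMr// mulrAC ler_pdivlMr//.
have := expR_ge1Dxn 1 (ltW lnk); rewrite lnK ?posrE// => le_u.
have : (2`!)%:R = 2 :> R by [].
by move=> f2; rewrite f2 in le_u; lra.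
Unshelve. all: by end_near. Qed.

Local Notation p k := ((nth_prime k)%:R : R).
Local Notation N k := ((primorial k)%:R : R).
Local Notation L k := (ln (N k)).

Lemma cvgy_ln_nat : ln (k%:R : R) @[k --> \oo] --> +oo.
Proof. exact/cvgy_ln/cvgr_idn. Qed.

Lemma ln_natr_le_nth_prime k : (0 < k)%N -> ln (k%:R : R) <= ln (p k).
Proof.
move=> k0; have p0 : (0 < nth_prime k)%N := leq_trans k0 (nth_prime_ge k).
by rewrite ler_ln ?posrE ?ltr0n// ler_nat nth_prime_ge.
Qed.

(** Chebyshev's bound reads [p ln 2 <= 4 k ln p]; its logarithm is
    [ln p + ln (ln 2) <= ln 4 + ln k + ln (ln p)], where [ln (ln p)] is
    negligible against [ln p]. *)
Lemma cvg_ln_nth_prime : ln (p k) / ln k%:R @[k --> \oo] --> (1 : R).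
Proof.
have lnpy : ln (p k) @[k --> \oo] --> +oo.
  apply/cvgryPge => A; near=> k; apply: le_trans (_ : ln k%:R <= _).
    by near: k; exact: (cvgry_ge cvgy_ln_nat).
  by apply: ln_natr_le_nth_prime; near: k; exact: nbhs_infty_gt.
suff inv_cvg : ln k%:R / ln (p k) @[k --> \oo] --> (1 : R).
  have cvg1 : (ln k%:R / ln (p k))^-1 @[k --> \oo] --> (1 : R).
    by rewrite -[X in _ --> X]invr1; exact: cvgV.
  apply: near_cvg cvg1 _.
  by near=> k; rewrite /= invf_div.
pose c : R := ln (ln 2) - ln 4.
apply: (@squeeze_cvgr _ _ _ _
  (fun k => 1 + c * (ln (p k))^-1 - ln (ln (p k)) / ln (p k)) (fun=> 1));
  last 2 first.
- rewrite -[X in _ --> X]subr0 -[in X in _ --> X](addr0 1).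
  apply: cvgB; last exact: cvg0_ln_div.
  apply: cvgD; first exact: cvg_cst.
  by rewrite -[0](mulr0 c); apply: cvgMr; exact: cvg0_invy.
- exact: cvg_cst.
near=> k; have k0 : (0 < k)%N by near: k; exact: nbhs_infty_gt.
have lnp : 0 < ln (p k) by near: k; exact: cvgry_gt.
have kR : 0 < k%:R :> R by rewrite ltr0n.
have pR : 0 < p k by rewrite ltr0n (leq_trans k0)// nth_prime_ge.
apply/andP; split; last by rewrite ler_pdivrMr// mul1r ln_natr_le_nth_prime.
have ln2 : 0 < ln (2 : R) by rewrite ln_gt0// ltr1n.
have : p k * ln 2 <= 4 * k%:R * ln (p k).
  have : ((2 ^ nth_prime k)%:R : R) <= (nth_prime k ^ (4 * k))%:R.
    by rewrite ler_nat expn2_nth_prime.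
  rewrite !natrX -ler_ln ?posrE ?exprn_gt0// !lnXn//.
  rewrite -[X in X <= _]mulr_natl -[X in _ <= X]mulr_natl.
  by rewrite natrM.
rewrite -ler_ln ?posrE ?mulr_gt0// !lnM ?posrE ?mulr_gt0// => le_ln.
rewrite -(ler_pM2r lnp) mulrBl mulrDl !mulfVK ?gt_eqF//.
by rewrite /c; lra.
Unshelve. all: by end_near. Qed.

(** The primorial is at least [k!], and [k ^ k / k! <= exp k] since the left
    side is one term of the exponential series at [k]. *)
Lemma ln_primorial_ge k : (0 < k)%N -> k%:R * ln k%:R - k%:R <= L k.
Proof.
case: k => // k _; set x : R := k.+1%:R; have x0 : 0 < x by rewrite ltr0n.
have f0 : 0 < (k.+1)`!%:R :> R by rewrite ltr0n fact_gt0.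
have lnf : ln (k.+1)`!%:R <= L k.+1.
  by rewrite ler_ln ?posrE// ?ler_nat ?fact_le_primorial// ltr0n primorial_gt0.
have : x ^+ k.+1 / (k.+1)`!%:R <= expR x.
  by apply: le_trans (expR_ge1Dxn k (ltW x0)); rewrite lerDr.
rewrite -ler_ln ?posrE ?divr_gt0 ?exprn_gt0 ?expR_gt0// expRK ln_div ?posrE ?exprn_gt0//.
rewrite lnXn// -[X in X - _]mulr_natl -/x; lra.
Qed.

Lemma ln_primorial_le k : L k <= k%:R * ln (p k).
Proof.
have [->|k0] := posnP k; first by rewrite primorial0 ln1 mul0r.
have pR : 0 < p k by rewrite ltr0n (leq_trans k0)// nth_prime_ge.
rewrite mulr_natl -lnXn// ler_ln ?posrE ?exprn_gt0// ?ltr0n ?primorial_gt0//.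
by rewrite -natrX ler_nat primorial_le_expn.
Qed.

Lemma cvg_ln_primorial : L k / (k%:R * ln k%:R) @[k --> \oo] --> (1 : R).
Proof.
apply: (@squeeze_cvgr _ _ _ _ (fun k => 1 - (ln k%:R)^-1)
  (fun k => ln (p k) / ln k%:R)); last 2 first.
- rewrite -[X in _ --> X]subr0; apply: cvgB; first exact: cvg_cst.
  exact/cvg0_invy/cvgy_ln_nat.
- exact: cvg_ln_nth_prime.
near=> k; have k0 : (0 < k)%N by near: k; exact: nbhs_infty_gt.
have kR : 0 < k%:R :> R by rewrite ltr0n.
have lnk : 0 < ln k%:R :> R by near: k; exact: (cvgry_gt cvgy_ln_nat).
have klnk : 0 < k%:R * ln k%:R :> R by rewrite mulr_gt0.
rewrite ler_pdivlMr// ler_pdivrMr//; apply/andP; split.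
  apply: le_trans (ln_primorial_ge k0); rewrite mulrBl mul1r.
  by rewrite [_^-1 * _]mulrC -mulrA divff ?mulr1// gt_eqF.
by rewrite [k%:R * _]mulrC mulrA mulfVK ?gt_eqF// mulrC ln_primorial_le.
Unshelve. all: by end_near. Qed.

Lemma cvgy_ln_primorial : L k @[k --> \oo] --> +oo.
Proof.
apply/cvgryPge => A; near=> k; have k0 : (0 < k)%N by near: k; exact: nbhs_infty_gt.
apply: le_trans (ln_primorial_ge k0).
have kR : 1 <= k%:R :> R by rewrite ler1n.
have : `|A| + 1 <= ln k%:R by near: k; exact: (cvgry_ge cvgy_ln_nat).
have := ler_norm A; have := normr_ge0 A; nra.
Unshelve. all: by end_near. Qed.

(** The quotient [r] of [L k] by [k ln k] tends to [1] and
    [ln (L k) = ln k + ln (ln k) + ln r], so [ln (L k)] is asymptotic to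
    [ln k]. *)
Lemma cvg_primorial_omega : k%:R / (L k / ln (L k)) @[k --> \oo] --> (1 : R).
Proof.
pose r k := L k / (k%:R * ln k%:R).
have r1 : r k @[k --> \oo] --> (1 : R) := cvg_ln_primorial.
have lnr : ln (r k) @[k --> \oo] --> (0 : R).
  rewrite -(@ln1 R); apply: (@continuous_cvg _ _ _ _ _ _ (@ln R)) => //.
  exact: continuous_ln.
have : ((1 + ln (ln k%:R) / ln k%:R + ln (r k) * (ln k%:R)^-1) / r k)
    @[k --> \oo] --> (1 : R).
  rewrite -[X in _ --> X]divr1; apply: cvgM; last exact: cvgV.
  rewrite -[X in _ --> X]addr0; apply: cvgD.
    rewrite -[X in _ --> X]addr0; apply: cvgD; first exact: cvg_cst.
    exact/cvg0_ln_div/cvgy_ln_nat.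
  rewrite -[X in _ --> X](mulr0 0); apply: cvgM => //.
  exact/cvg0_invy/cvgy_ln_nat.
move=> cvg1; apply: near_cvg cvg1 _; near=> k.
have k0 : 0 < k%:R :> R by rewrite ltr0n; near: k; exact: nbhs_infty_gt.
have lnk : 0 < ln k%:R :> R by near: k; exact: (cvgry_gt cvgy_ln_nat).
have Lk : 0 < L k by near: k; exact: (cvgry_gt cvgy_ln_primorial).
have klnk : 0 < k%:R * ln k%:R :> R by rewrite mulr_gt0.
rewrite invf_div; have -> : ln (L k) = ln k%:R + ln (ln k%:R) + ln (r k).
  by rewrite -!lnM ?posrE ?divr_gt0// /r mulrC mulfVK ?gt_eqF.
by rewrite /r; field; rewrite !gt_eqF.
Unshelve. all: by end_near. Qed.

Lemma near_le_natr (A : R) : \forall k \near \oo, A <= k%:R.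
Proof. exact: (cvgry_ge (@cvgr_idn R)). Qed.

(** The size condition of [pdd_primorial_ge]: the primorial grows like
    [exp (k ln k)], while the left side is only exponential in [k]. *)
Lemma near_nth_prime_growth : \forall k \near \oo,
  (4 * nth_prime k ^ 2 * 4 ^ k.-1 <= primorial k.-1)%N.
Proof.
near=> k.
have k1 : (1 < k)%N by near: k; exact: nbhs_infty_gt.
have p_le : ln (p k) / ln k%:R <= 2.
  near: k; apply: (cvgr_le _ cvg_ln_nth_prime); first by rewrite ltr1n.
(* [20] is a safe margin: with [k = m + 1], the logarithm of the left side is at
   most [3 + 7 m], and that of the right side at least [19 m]. *)
have k_ge : expR 20 + 1 <= (k%:R : R) by near: k; exact: near_le_natr.
case: (k) k1 p_le k_ge => // m m0 p_le k_ge; rewrite succnK.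
rewrite ltnS in m0.
have mR : 1 <= m%:R :> R by rewrite ler1n.
have mS : m.+1%:R = 1 + m%:R :> R by rewrite -natr1 addrC.
have lnm : 20 <= ln m%:R :> R.
  rewrite -[20]expRK ler_ln ?posrE ?expR_gt0//; last by rewrite (lt_le_trans _ mR).
  by rewrite mS in k_ge; lra.
have lnp : ln (p m.+1) <= 2 * m%:R.
  rewrite ler_pdivrMr in p_le; last by rewrite ln_gt0 // ltr1n.
  apply: le_trans p_le _; rewrite ler_pM2l//.
  by rewrite mS le_ln1Dx//; lra.
have pR : 0 < p m.+1 by rewrite ltr0n prime_gt0 ?prime_nth_prime.
have ln4 : ln 4 <= 3 :> R.
  have -> : 4 = 1 + 3 :> R by ring.
  by rewrite le_ln1Dx//; lra.
have p0 : (0 < nth_prime m.+1)%N by rewrite prime_gt0 ?prime_nth_prime.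
rewrite -(ler_nat R) !natrM !natrX -ler_ln ?posrE
  ?mulr_gt0 ?exprn_gt0 ?ltr0n ?primorial_gt0//.
apply: le_trans (ln_primorial_ge m0).
rewrite !lnM ?posrE ?mulr_gt0 ?exprn_gt0// !lnXn//.
by rewrite -[ln 4 *+ _]mulr_natl; nra.
Unshelve. all: by end_near. Qed.

Local Notation g k :=
  (2 `^ ((num_divisors (primorial k))%:R / 4) * L k / (N k * ln (L k)) : R).

(** The exponent is a natural number as soon as [4] divides [2 ^ k]. *)
Lemma powR_num_divisors k : (1 < k)%N ->
  2 `^ ((num_divisors (primorial k))%:R / 4) = (2 ^ 2 ^ k.-2)%:R :> R.
Proof.
case: k => [|[|k]]// _; rewrite num_divisors_primorial /=.
have -> : (2 ^ k.+2)%:R / 4 = (2 ^ k)%:R :> R.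
  by rewrite !expnS mulnA mulnC natrM mulfK// pnatr_eq0.
by rewrite powR_mulrn ?ler0n// natrX.
Qed.

(** The factor [ln N / (N ln (ln N))] is at most [1] eventually, so the bound
    [2 ^ (d / 4)] is more than enough. *)
Lemma near_pdd_primorial_ge : \forall k \near \oo, g k <= (pdd (primorial k))%:R.
Proof.
near=> k.
have k1 : (1 < k)%N by near: k; exact: nbhs_infty_gt.
have growth : (4 * nth_prime k ^ 2 * 4 ^ k.-1 <= primorial k.-1)%N.
  by near: k; exact: near_nth_prime_growth.
have NR : 0 < N k by rewrite ltr0n primorial_gt0.
have LR : 0 < L k by near: k; exact: (cvgry_gt cvgy_ln_primorial).
have lnLk : 1 <= ln (L k) by near: k; exact: (cvgry_ge (cvgy_ln cvgy_ln_primorial)).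
apply: (@le_trans _ _ (2 `^ ((num_divisors (primorial k))%:R / 4))).
  rewrite -mulrA ger_pMr ?powR_gt0// ler_pdivrMr ?mul1r ?mulr_gt0 ?(lt_le_trans _ lnLk)//.
  by rewrite (le_trans (ltW (ln_sublinear NR)))// ler_peMr// ltW.
rewrite powR_num_divisors// ler_nat.
by case: (k) k1 growth => // m _ /pdd_primorial_ge.
Unshelve. all: by end_near. Qed.

(** The logarithm of [2 ^ (d / 4)] is [2 ^ k / 4 * ln 2]; the other factors
    contribute between [- 2 L k] and [0], where [L k] is polynomial in [k], so
    they are absorbed by halving the main term. *)
Lemma near_ln_bounds : \forall k \near \oo,
  0 < g k /\ 2 ^+ k / 8 * ln 2 <= ln (g k) <= 2 ^+ k / 4 * ln 2.
Proof.
near=> k.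
have k0 : (0 < k)%N by near: k; exact: nbhs_infty_gt.
have kR : 0 < k%:R :> R by rewrite ltr0n.
have ln2 : 0 < ln 2 :> R by rewrite ln_gt0 ?ltr1n.
have k_ge : 192 / ln 2 ^+ 4 <= k%:R :> R by near: k; exact: near_le_natr.
have lnk : 0 < ln k%:R :> R by near: k; exact: (cvgry_gt cvgy_ln_nat).
have NR : 0 < N k by rewrite ltr0n primorial_gt0.
have LR : 0 < L k by near: k; exact: (cvgry_gt cvgy_ln_primorial).
have lnLk : 1 <= ln (L k) by near: k; exact: (cvgry_ge (cvgy_ln cvgy_ln_primorial)).
have lnLR : 0 < ln (L k) by rewrite (lt_le_trans _ lnLk).
have gR : 0 < g k by rewrite divr_gt0 ?mulr_gt0 ?powR_gt0.
split => //.
rewrite ln_div ?posrE ?mulr_gt0 ?powR_gt0// !lnM ?posrE ?powR_gt0// ln_powR.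
rewrite num_divisors_primorial natrX.
have lnL_le : ln (L k) <= L k := ltW (ln_sublinear LR).
have lnlnL_le : ln (ln (L k)) <= ln (L k) := ltW (ln_sublinear lnLR).
have lnlnL_ge : 0 <= ln (ln (L k)) by exact: ln_ge0.
have L_le : L k <= 2 * k%:R ^+ 2.
  have : L k / (k%:R * ln k%:R) <= 2.
    by near: k; apply: (cvgr_le _ cvg_ln_primorial); rewrite ltr1n.
  rewrite ler_pdivrMr ?mulr_gt0// => /le_trans; apply.
  by rewrite expr2 !ler_pM2l// ltW// ln_sublinear.
have pow_ge : (k%:R * ln 2) ^+ 3 / 6 <= 2 ^+ k :> R.
  have : 0 <= k%:R * ln 2 :> R by rewrite mulr_ge0// ltW.
  move=> /(expR_ge1Dxn 2); rewrite mulr_natl -lnXn// lnK ?posrE ?exprn_gt0//.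
  by apply: le_trans; rewrite lerDr.
(* A cubic lower bound for [2 ^ k = exp (k ln 2)] beats the quadratic one for
   [L k] from the threshold [192 / ln 2 ^ 4] on. *)
have : 4 * k%:R ^+ 2 <= 2 ^+ k / 8 * ln 2 :> R.
  apply: (@le_trans _ _ ((k%:R * ln 2) ^+ 3 / 6 / 8 * ln 2)); last first.
    by rewrite ler_pM2r// ler_pM2r.
  rewrite ler_pdivrMr ?exprn_gt0// in k_ge.
  have -> : (k%:R * ln 2) ^+ 3 / 6 / 8 * ln 2 = k%:R ^+ 2 * (k%:R * ln 2 ^+ 4) / 48 :> R.
    by field.
  have := exprn_ge0 2 (ltW kR); nra.
by lra.
Unshelve. all: by end_near. Qed.

(** By the previous bounds, [ln (ln (g k))] is [k ln 2] up to a bounded error,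
    and [k] is asymptotic to [L k / ln (L k)], which tends to infinity. *)
Lemma cvg_lnln_bound :
  ln (ln (g k)) / (L k / ln (L k)) - ln 2 @[k --> \oo] --> (0 : R).
Proof.
have ln2 : 0 < ln 2 :> R by rewrite ln_gt0 ?ltr1n.
have cvg_affine (c : R) :
    k%:R / (L k / ln (L k)) * ln 2 + c * (ln (L k) / L k) - ln 2 @[k --> \oo] --> (0 : R).
  rewrite -[X in _ --> X](subrr (ln 2)); apply: cvgB; last exact: cvg_cst.
  rewrite -[X in _ --> X]addr0; apply: cvgD.
    by rewrite -[X in _ --> X]mul1r; apply: cvgMl; exact: cvg_primorial_omega.
  rewrite -[X in _ --> X](mulr0 c); apply: cvgMr.
  exact/cvg0_ln_div/cvgy_ln_primorial.
apply: squeeze_cvgr (cvg_affine (ln (ln 2 / 8))) (cvg_affine (ln (ln 2 / 4))).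
near=> k.
have LR : 0 < L k by near: k; exact: (cvgry_gt cvgy_ln_primorial).
have lnLk : 1 <= ln (L k) by near: k; exact: (cvgry_ge (cvgy_ln cvgy_ln_primorial)).
have lnLR : 0 < ln (L k) by rewrite (lt_le_trans _ lnLk).
have [_ /andP[lo hi]] : 0 < g k /\ 2 ^+ k / 8 * ln 2 <= ln (g k) <= 2 ^+ k / 4 * ln 2.
  by near: k; exact: near_ln_bounds.
have lo0 : 0 < 2 ^+ k / 8 * ln 2 :> R by rewrite !mulr_gt0// exprn_gt0.
have lnE (c : R) : 0 < c -> ln (2 ^+ k / c * ln 2) = k%:R * ln 2 + ln (ln 2 / c).
  move=> c0; rewrite mulrAC -mulrA [LHS]lnM ?posrE ?exprn_gt0 ?divr_gt0//.
  by rewrite lnXn// mulr_natl.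
have W0 : 0 < ln (g k) := lt_le_trans lo0 lo.
have uE (x c : R) : (x * ln 2 + c) / (L k / ln (L k))
    = x / (L k / ln (L k)) * ln 2 + c * (ln (L k) / L k).
  by field; rewrite !gt_eqF.
rewrite !lerD2r -!uE !ler_pM2r ?invr_gt0 ?divr_gt0// -!lnE//.
by rewrite !ler_ln ?posrE// ?lo// (lt_le_trans W0).
Unshelve. all: by end_near. Qed.

End Asymptotics.

Theorem theorem3 (R : realType) :
  let n := primorial in
  let N := fun k : nat => (n k)%:R : R in
  let g := fun k : nat =>
    2 `^ ((num_divisors (n k))%:R / 4) * ln (N k) / (N k * ln (ln (N k))) in
  (forall k : nat, (0 < k)%N -> pdd (n k) = pdsd (n k)) /\
  gtrsim (fun k : nat => (pdd (n k))%:R) g /\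
  (exists2 e : nat -> R, e @ \oo --> (0 : R) &
    \forall k \near \oo,
      g k = expR (expR ((ln 2 + e k) * (ln (N k) / ln (ln (N k)))))).
Proof.
move=> n N g; split; first by move=> k _; exact: pdd_primorial.
split.
  exists (fun=> 0); first exact: cvg_cst.
  near=> k; rewrite addr0 mul1r; near: k; exact: near_pdd_primorial_ge.
exists (fun k => ln (ln (g k)) / (ln (N k) / ln (ln (N k))) - ln 2).
  exact: cvg_lnln_bound.
near=> k.
have LR : 0 < ln (N k) by near: k; exact: (cvgry_gt (@cvgy_ln_primorial R)).
have lnLR : 0 < ln (ln (N k)) by near: k; exact: (cvgry_gt (cvgy_ln (@cvgy_ln_primorial R))).
have [gR /andP[lo _]] : 0 < g k /\ 2 ^+ k / 8 * ln 2 <= ln (g k) <= 2 ^+ k / 4 * ln 2.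
  by near: k; exact: near_ln_bounds.
have ln2 : 0 < ln 2 :> R by rewrite ln_gt0 ?ltr1n.
have W0 : 0 < ln (g k) by rewrite (lt_le_trans _ lo)// !mulr_gt0// exprn_gt0.
by rewrite addrC subrK mulfVK ?gt_eqF ?divr_gt0// !lnK ?posrE.
Unshelve. all: by end_near. Qed.
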